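(* Let $F$ be a field and let $\Gamma=\Gamma_0\oplus\Gamma_1$ be a $\Gamma$-algebra over $F$ with commutative even part $\Gamma_0$. Then $\Gamma$ is a Jordan superalgebra. Moreover, if $\mathrm{char}\,F=3$ then $\Gamma$ is an alternative superalgebra.
   Context: Algebras are not assumed associative; $[a,b]=ab-ba$, $(a,b,c)=(ab)c-a(bc)$, and $Z(\cdot)$ denotes the center. A $\Gamma$-algebra is a $\mathbb Z_2$-graded $F$-algebra $\Gamma=\Gamma_0\oplus\Gamma_1$ such that: (i) $\Gamma_0$ is a unital associative algebra, $[\Gamma_0,\Gamma_1]=0$ and $(\Gamma_0,\Gamma,\Gamma)=0$ (associators whose first entry is in $\Gamma_0$ vanish); (ii) $\Gamma_1^2\subseteq Z(\Gamma_0)$; (iii) $xy+yx=0$ for $x,y\in\Gamma_1$; (iv) $(xy)z+(yz)x+(zx)y=0$ for $x,y,z\in\Gamma_1$. For a superalgebra ($\mathbb Z_2$-graded algebra) put $\bar x=i$ for $x$ homogeneous of degree $i$. It is commutative if $xy=(-1)^{\bar x\bar y}yx$ for homogeneous $x,y$. A commutative superalgebra is a Jordan superalgebra if for all homogeneous $x,y,z,t$ $$(xy,z,t)+(-1)^{\bar y\bar z+\bar y\bar t+\bar z\bar t}(xt,z,y)+(-1)^{\bar x(\bar y+\bar z+\bar t)+\bar z\bar t}(yt,z,x)=0.$$ A superalgebra is alternative (in characteristic $\ne2$) if $(x,y,z)=-(-1)^{\bar x\bar y}(y,x,z)$ and $(x,y,z)=-(-1)^{\bar y\bar z}(x,z,y)$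 for all homogeneous $x,y,z$. *)

(* Defs.v *)
From mathcomp Require Import all_boot all_order all_algebra.

Set Implicit Arguments.
Unset Strict Implicit.
Unset Printing Implicit Defensive.

Import GRing.Theory.
Local Open Scope ring_scope.

(* A Z_2-graded F-algebra A = A_0 (+) A_1: no associativity, no identity      *)
(* element and no finiteness is assumed; [grade i] is the set of homogeneous  *)
(* elements of degree i (0 is homogeneous of both degrees).                   *)
Record superalgebra (F : fieldType) := Superalgebra {
  sa_sort :> lmodType F;
  smul : {bilinear sa_sort -> sa_sort -> sa_sort};
  grade : 'Z_2 -> sa_sort -> Prop;
  grade_zero : forall i, grade i 0;
  grade_linear : forall i (a : F) x y,
    grade i x -> grade i y -> grade i (a *: x + y);
  grade_sum : forall x, exists x0 x1,
    [/\ grade 0 x0, grade 1 x1 & x = x0 + x1];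
  grade_direct : forall x, grade 0 x -> grade 1 x -> x = 0;
  grade_mul : forall i j x y,
    grade i x -> grade j y -> grade (i + j) (smul x y)
}.

Arguments smul {F s}.
Arguments grade {F s}.

Section SuperalgebraTheory.
Variables (F : fieldType) (A : superalgebra F).
Implicit Types (B : A -> Prop) (x y z t : A) (i j k l : 'Z_2).

Local Notation "x ** y" := (smul x y) (at level 40, left associativity).

Definition commutator x y : A := x ** y - y ** x.

Definition associator x y z : A := (x ** y) ** z - x ** (y ** z).

(* The center of a subalgebra B: the elements of B which commute and          *)
(* associate with all elements of B.                                          *)
Definition center B z : Prop :=
  [/\ B z,
      forall x, B x -> commutator z x = 0
    & forall x y, B x -> B y ->
        [/\ associator z x y = 0, associator x z y = 0
          & associator x y z = 0]].

(* In (i), the identity e is an identity of the even part only: it is not     *)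
(* required to act as the identity on the odd part.                           *)
Record Gamma_algebra : Prop := GammaAlgebra {
  Gamma_unital : exists2 e : A, grade 0 e &
    forall a, grade 0 a -> e ** a = a /\ a ** e = a;
  Gamma_assoc : forall a b c : A, grade 0 a -> grade 0 b -> grade 0 c ->
    associator a b c = 0;
  Gamma_comm01 : forall a x, grade 0 a -> grade 1 x -> commutator a x = 0;
  Gamma_nucl : forall a x y, grade 0 a -> associator a x y = 0;
  Gamma_odd_sq : forall x y, grade 1 x -> grade 1 y ->
    center (grade 0) (x ** y);
  Gamma_anticomm : forall x y, grade 1 x -> grade 1 y ->
    x ** y + y ** x = 0;
  Gamma_jacobi : forall x y z, grade 1 x -> grade 1 y -> grade 1 z ->
    (x ** y) ** z + (y ** z) ** x + (z ** x) ** y = 0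
}.

Definition even_commutative : Prop :=
  forall a b : A, grade 0 a -> grade 0 b -> commutator a b = 0.

(* In the sign exponents below, degrees in 'Z_2 are read as the naturals 0    *)
(* and 1.                                                                     *)
Definition supercommutative : Prop :=
  forall i j x y, grade i x -> grade j y ->
    x ** y = (-1) ^+ (i * j) *: (y ** x).

Definition Jordan_superalgebra : Prop :=
  supercommutative /\
  forall i j k l x y z t,
    grade i x -> grade j y -> grade k z -> grade l t ->
    associator (x ** y) z t
    + (-1) ^+ (j * k + j * l + k * l) *: associator (x ** t) z y
    + (-1) ^+ (i * (j + k + l) + k * l) *: associator (y ** t) z x = 0.

(* This is the linearized form of super-alternativity, which is the right     *)
(* notion only when the characteristic of F is not 2.                         *)
Definition alternative_superalgebra : Prop :=
  forall i j k x y z, grade i x -> grade j y -> grade k z ->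
    associator x y z = - ((-1) ^+ (i * j) *: associator y x z) /\
    associator x y z = - ((-1) ^+ (j * k) *: associator x z y).

End SuperalgebraTheory.

(* Main.v *)
Require Import Defs.
From mathcomp Require Import all_boot all_order all_algebra.

Set Implicit Arguments.
Unset Strict Implicit.
Unset Printing Implicit Defensive.

Import GRing.Theory.
Local Open Scope ring_scope.

(** When the even part is commutative, even elements commute with everything
    and can be moved to the front of any product ([Gamma_nucl]); together with
    the anticommutativity of odd elements this kills every associator with an
    even entry ([associator_even]).  The surviving associators have three odd
    entries, and for these (x,y,z) = (xy)z - (yz)x ([associator_oddE]), an
    expression invariant under the reversal x <-> z ([associator_rev]).

    A term of the Jordan identity therefore survives only if z is odd and
    exactly one of x, y, t is even.  That even element factors out of the two
    surviving terms, which carry opposite signs, and what remains is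
    (u,z,v) - (v,z,u) = 0.

    In characteristic 3 the identity (xy)z + (yz)x + (zx)y = 0 makes
    (xy)z - (yz)x invariant under cyclic shifts as well ([associator_cyc]).
    A cyclic shift and the reversal generate all permutations, so the
    associator is symmetric on odd elements, as super-alternativity demands. *)

Lemma Z2_cases (i : 'Z_2) : i = 0 \/ i = 1.
Proof. by case: i => [[|[|//]]] ?; [left | right]; apply/val_inj. Qed.

Section CommutativeEvenPart.
Variables (F : fieldType) (G : superalgebra F).
Hypotheses (hG : Gamma_algebra G) (hcomm : even_commutative G).
Implicit Types (a x y z t : G) (i j k : 'Z_2).

Local Notation "x ** y" := (smul x y) (at level 40, left associativity).

Lemma grade_even_mul a i x : grade 0 a -> grade i x -> grade i (a ** x).
Proof. by move=> ha hx; rewrite -[i]add0r; apply: grade_mul. Qed.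

Lemma grade_odd_mul x y : grade 1 x -> grade 1 y -> grade 0 (x ** y).
Proof.
move=> hx hy; rewrite (_ : 0 = 1 + 1 :> 'Z_2); last exact/val_inj.
exact: grade_mul.
Qed.

Lemma even_central a i x : grade 0 a -> grade i x -> a ** x = x ** a.
Proof.
move=> ha; case: (Z2_cases i) => -> hx; apply/subr0_eq.
  exact: hcomm.
exact: (Gamma_comm01 hG).
Qed.

Lemma even_mulA a x y : grade 0 a -> (a ** x) ** y = a ** (x ** y).
Proof. by move=> ha; apply/subr0_eq/(Gamma_nucl hG). Qed.

Lemma odd_anticomm x y : grade 1 x -> grade 1 y -> x ** y = - (y ** x).
Proof. by move=> hx hy; apply/eqP; rewrite -addr_eq0 (Gamma_anticomm hG). Qed.

Lemma even_odd_odd_swap a x y : grade 0 a -> grade 1 x -> grade 1 y ->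
  x ** (a ** y) = a ** (x ** y).
Proof.
move=> ha hx hy.
have hay : grade 1 (a ** y) by apply: grade_even_mul.
by rewrite (odd_anticomm hx hay) even_mulA // (odd_anticomm hx hy) linearNr.
Qed.

Lemma Gamma_supercommutative : supercommutative G.
Proof.
move=> i j x y; case: (Z2_cases i) => ->; case: (Z2_cases j) => -> hx hy /=.
- by rewrite scale1r; apply: even_central hy.
- by rewrite scale1r; apply: even_central hy.
- by rewrite scale1r; apply/esym/(even_central hy hx).
- by rewrite expr1 scaleN1r; apply: odd_anticomm.
Qed.

(** For x, y odd: (xa)y = a(xy), while x(ay) = -(ay)x = -a(yx) = a(xy). *)
Lemma associator_even_mid i j x a y : grade 0 a -> grade i x -> grade j y ->
  associator x a y = 0.
Proof.
move=> ha; case: (Z2_cases i) => -> hx; first by rewrite (Gamma_nucl hG).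
case: (Z2_cases j) => -> hy; rewrite /associator -(even_central ha hx).
  have hay : grade 0 (a ** y) by apply: grade_even_mul.
  have hax : grade 1 (a ** x) by apply: grade_even_mul.
  (* both sides become y(ax) *)
  rewrite -(even_central hay hx) (even_central ha hy) -(even_central hy hax).
  by rewrite (even_mulA _ _ hy) subrr.
by rewrite (even_mulA _ _ ha) (even_odd_odd_swap ha hx hy) subrr.
Qed.

Lemma associator_even_right i j x y a : grade i x -> grade j y -> grade 0 a ->
  associator x y a = 0.
Proof.
move=> hx hy ha; case: (Z2_cases i) hx => -> hx.
  by rewrite (Gamma_nucl hG).
case: (Z2_cases j) hy => -> hy; first by rewrite (associator_even_mid hy hx ha).
have hxy := grade_odd_mul hx hy.
rewrite /associator -(even_central ha hxy) -(even_central ha hy).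
by rewrite (even_odd_odd_swap ha hx hy) subrr.
Qed.

Lemma associator_even i j k x y z : grade i x -> grade j y -> grade k z ->
  [|| i == 0, j == 0 | k == 0] -> associator x y z = 0.
Proof.
move=> hx hy hz /or3P[] /eqP e; subst.
- exact: (Gamma_nucl hG).
- exact: associator_even_mid hy hx hz.
- exact: associator_even_right hx hy hz.
Qed.

Lemma associator_oddE x y z : grade 1 x -> grade 1 y -> grade 1 z ->
  associator x y z = (x ** y) ** z - (y ** z) ** x.
Proof.
move=> hx hy hz; have hyz : grade 0 (y ** z) by apply: grade_odd_mul.
by rewrite /associator (even_central hyz hx).
Qed.

Lemma associator_rev x y z : grade 1 x -> grade 1 y -> grade 1 z ->
  associator x y z = associator z y x.
Proof.
move=> hx hy hz; rewrite !associator_oddE //.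
by rewrite (odd_anticomm hz hy) (odd_anticomm hy hx) !linearNl opprK addrC.
Qed.

Lemma associator_even_factor a x y z : grade 0 a ->
  associator (a ** x) y z = a ** associator x y z.
Proof. by move=> ha; rewrite /associator !(even_mulA _ _ ha) linearBr. Qed.

(** The even factor can migrate between the two ends of the associator: this
    is the cancellation in each of the three nontrivial cases of the Jordan
    identity. *)
Lemma associator_even_factor_rev a x y z :
  grade 0 a -> grade 1 x -> grade 1 y -> grade 1 z ->
  associator (a ** x) y z = associator (a ** z) y x.
Proof. by move=> *; rewrite !associator_even_factor // associator_rev. Qed.

Lemma Gamma_Jordan : Jordan_superalgebra G.
Proof.
split=> [|i j k l x y z t hx hy hz ht]; first exact: Gamma_supercommutative.
have hxy := grade_mul hx hy; have hxt := grade_mul hx ht.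
have hyt := grade_mul hy ht.
case: (Z2_cases k) => ?; subst k.
  rewrite (associator_even hxy hz ht) ?eqxx ?orbT //.
  rewrite (associator_even hxt hz hy) ?eqxx ?orbT //.
  by rewrite (associator_even hyt hz hx) ?eqxx ?orbT // !scaler0 !addr0.
case: (Z2_cases i) => ?; case: (Z2_cases j) => ?; case: (Z2_cases l) => ?; subst;
  (* all terms vanish unless exactly one of x, y, t is even *)
  try by rewrite (associator_even hxy hz ht) // (associator_even hxt hz hy) //
         (associator_even hyt hz hx) // !scaler0 !addr0.
- rewrite (associator_even hyt hz hx) // scaler0 addr0 /=.
  rewrite (associator_even_factor_rev hx hy hz ht).
  by rewrite exprS sqrrN expr1n mulr1 scaleN1r subrr.
- rewrite (associator_even hxt hz hy) // scaler0 addr0 /=.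
  rewrite -(even_central hy hx) (associator_even_factor_rev hy hx hz ht).
  by rewrite exprS sqrrN expr1n mulr1 scaleN1r subrr.
- rewrite (associator_even hxy hz ht) // add0r /=.
  rewrite -(even_central ht hx) -(even_central ht hy).
  rewrite (associator_even_factor_rev ht hx hz hy).
  by rewrite sqrrN expr1n expr1 scaleN1r scale1r addNr.
Qed.

(** With p = (xy)z, q = (yz)x and r = (zx)y, the two associators are p - q and
    q - r; they differ by p + q + r - 3q. *)
Lemma associator_cyc x y z : 3%N \in [pchar F] ->
  grade 1 x -> grade 1 y -> grade 1 z -> associator x y z = associator y z x.
Proof.
move=> char3 hx hy hz; rewrite !associator_oddE //.
have := Gamma_jacobi hG hx hy hz.
set p := (x ** y) ** z; set q := (y ** z) ** x; set r := (z ** x) ** y => pqr0.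
apply/subr0_eq.
have -> : p - q - (q - r) = (p + q + r) - q *+ 3.
  apply/(addIr (q *+ 3)); rewrite subrK opprB (mulrSr q 2) mulr2n addrA.
  by rewrite addrACA !subrK addrAC.
by rewrite pqr0 -scaler_nat (pcharf0 char3) scale0r subr0.
Qed.

Lemma Gamma_alternative : 3%N \in [pchar F] -> alternative_superalgebra G.
Proof.
move=> char3 i j k x y z hx hy hz.
have [e|] := boolP [|| i == 0, j == 0 | k == 0].
  rewrite (associator_even hx hy hz) // (associator_even hy hx hz) 1?orbCA //.
  by rewrite (associator_even hx hz hy) ?scaler0 ?oppr0 // [(k == 0) || _]orbC.
case: (Z2_cases i) hx => -> hx //; case: (Z2_cases j) hy => -> hy //.
case: (Z2_cases k) hz => -> hz // _.
rewrite /= expr1 !scaleN1r !opprK; split.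
  by rewrite (associator_rev hy hx hz) [RHS]associator_cyc.
by rewrite (associator_rev hx hz hy) associator_cyc.
Qed.

End CommutativeEvenPart.

Theorem proposition2 (F : fieldType) (G : superalgebra F)
    (hG : Gamma_algebra G) (hcomm : even_commutative G) :
  Jordan_superalgebra G /\
  (3%N \in [pchar F] -> alternative_superalgebra G).
Proof. by split; [apply: Gamma_Jordan | apply: Gamma_alternative]. Qed.
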